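(* There is a unique shift for which, asymptotically, half of the integers in an $\alpha$-shifted, $\nu$-offset, floor sequence are odd and half are even, and it does not depend on $\nu$. Precisely: there exists $\alpha_0\in[0,1]$ such that, for every $\nu\in\mathbb{R}$, $\alpha_0$ is the unique $\alpha\in[0,1]$ satisfying $$\lim_{n\to\infty}\frac{1}{n}\mathcal{N}_{n,\alpha,\nu,1,2}=\lim_{n\to\infty}\frac{1}{n}\mathcal{N}_{n,\alpha,\nu,2,2}=\frac12.$$
   Context: For $\alpha,\nu\in\mathbb{R}$ and a positive integer $n$, the $\alpha$-shifted, $\nu$-offset, floor sequence of length $n$ is $\left\lfloor\frac{n-\nu}{1}+\alpha\right\rfloor,\left\lfloor\frac{n-\nu}{2}+\alpha\right\rfloor,\dots,\left\lfloor\frac{n-\nu}{n}+\alpha\right\rfloor$. For $r\in\mathbb{Z}$ and a positive integer $m$, $$\mathcal{N}_{n,\alpha,\nu,r,m}=\#\left\{k\in\mathbb{Z} : 1\le k\le n,\ \left\lfloor\frac{n-\nu}{k}+\alpha\right\rfloor\equiv r \pmod m\right\}$$ is the number of terms of this sequence congruent to $r$ modulo $m$; so $\mathcal{N}_{n,\alpha,\nu,1,2}$ counts the odd terms and $\mathcal{N}_{n,\alpha,\nu,2,2}$ the even terms. *)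

(* Defs.v *)
From HB Require Import structures.
From mathcomp Require Import all_boot all_order all_algebra.
From mathcomp Require Import reals classical_sets topology normedtype sequences.

Set Implicit Arguments.
Unset Strict Implicit.
Unset Printing Implicit Defensive.

Import Order.TTheory GRing.Theory Num.Theory.
Import numFieldNormedType.Exports.

Local Open Scope ring_scope.

Definition floor_term (R : realType) (n : nat) (alpha nu : R) (k : nat) : int :=
  Num.floor ((n%:R - nu) / k%:R + alpha).

Definition floor_count (R : realType) (n : nat) (alpha nu : R) (r : int)
    (m : nat) : nat :=
  #|[set k : 'I_n.+1 | (1 <= k)%N &&
       (floor_term n alpha nu k == r %[mod m%:Z])%Z]|.

(* Main.v *)
(** The terms equal to [j >= 2] occupy the asymptotic proportion
    [1 / (j - alpha) - 1 / (j + 1 - alpha)] of the indices, so whatever [nu] the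
    even terms have density [S alpha = \sum_i (-1)^i / (2 - alpha + i)]. Summed
    termwise, [S beta - S alpha] is again a Leibniz alternating series, hence lies
    strictly above [0] and below [beta - alpha] when [alpha < beta]: [S] is strictly
    increasing and continuous. Since [S 0 <= 1 / 2 <= S 1], it takes the value [1 / 2]
    exactly once. *)

Require Import Defs.
From HB Require Import structures.
From mathcomp Require Import all_boot all_order all_algebra.
From mathcomp Require Import reals classical_sets topology normedtype sequences.
From mathcomp Require Import boolp realfun.
From mathcomp Require Import zify ring lra.

Set Implicit Arguments.
Unset Strict Implicit.
Unset Printing Implicit Defensive.

Import Order.TTheory GRing.Theory Num.Theory.
Import numFieldNormedType.Exports.

Local Open Scope classical_set_scope.
Local Open Scope ring_scope.

(** * Leibniz bounds for alternating sums *)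

Section AlternatingSums.
Variable R : realType.
Implicit Types (f g : nat -> R) (M N i : nat).

Definition altsum f N : R := \sum_(i < N) (-1) ^+ i * f i.

(** For a nonincreasing [f] the even partial sums are monotone, so boundedness alone gives the
    limit. *)
Definition altlim f : R := limn (fun M => altsum f M.*2).

Lemma altsumSl f N : altsum f N.+1 = f 0%N - altsum (fun i => f i.+1) N.
Proof.
rewrite /altsum big_ord_recl expr0 mul1r -sumrN; congr (_ + _).
by apply: eq_bigr => i _; rewrite lift0 exprS mulN1r mulNr.
Qed.

Lemma altsumSr f N : altsum f N.+1 = altsum f N + (-1) ^+ N * f N.
Proof. by rewrite /altsum big_ord_recr. Qed.

Lemma altsumB f g N : altsum (f \- g) N = altsum f N - altsum g N.
Proof. by rewrite /altsum -sumrB; apply: eq_bigr => i _; rewrite mulrBr. Qed.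

Lemma altsum_doubleS f M :
  altsum f M.+1.*2 = altsum f M.*2 + (f M.*2 - f M.*2.+1).
Proof.
have sgn1 : (-1) ^+ M.*2 = 1 :> R by rewrite -signr_odd odd_double.
by rewrite doubleS !altsumSr exprS sgn1; ring.
Qed.

(** Peeling off the first term leaves [f 0] minus the alternating sum of the shifted sequence, which
    by induction lies between [0] and [f 1 <= f 0]. *)
Lemma altsum_bounds f N : (forall i, 0 <= f i) -> (forall i, f i.+1 <= f i) ->
  0 <= altsum f N <= f 0%N.
Proof.
elim: N f => [|N IH] f f_ge0 f_noninc; first by rewrite /altsum big_ord0 lexx /=.
have /andP[] := IH (fun i => f i.+1) (fun i => f_ge0 _) (fun i => f_noninc _).
rewrite altsumSl; have := f_noninc 0%N; lra.
Qed.

Section Leibniz.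
Variable f : nat -> R.
Hypotheses (f_ge0 : forall i, 0 <= f i) (f_noninc : forall i, f i.+1 <= f i).

Let even_nondec : {homo (fun M => altsum f M.*2) : m n / (m <= n)%N >-> m <= n}.
Proof.
apply/nondecreasing_seqP => M.
by rewrite altsum_doubleS lerDl subr_ge0.
Qed.

Lemma is_cvg_altsum : cvgn (fun M => altsum f M.*2).
Proof.
apply: nondecreasing_is_cvgn even_nondec _.
by exists (f 0%N) => _ [M _ <-]; have /andP[] := altsum_bounds M.*2 f_ge0 f_noninc.
Qed.

Lemma altlim_le : altlim f <= f 0%N.
Proof.
apply: limr_le is_cvg_altsum _; apply: nearW => M.
by have /andP[] := altsum_bounds M.*2 f_ge0 f_noninc.
Qed.

Lemma altlim_ge M : altsum f M.*2 <= altlim f.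
Proof. exact: nondecreasing_cvgn_le even_nondec is_cvg_altsum M. Qed.

(** Past an even index the signs start again at [+], so every later tail is an alternating sum of
    the shifted sequence, at most its first term [f M.*2]. *)
Lemma altlim_leD M : altlim f <= altsum f M.*2 + f M.*2.
Proof.
apply: limr_le is_cvg_altsum _; exists M => // m /= leMm.
have [k ->] : exists k, m.*2 = (M.*2 + k)%N by exists (m - M).*2; lia.
rewrite /altsum big_split_ord /= lerD2l.
have /andP[_] := altsum_bounds k (fun i => f_ge0 (M.*2 + i))
  (fun i => eq_ind_r (fun j => f j <= _) (f_noninc _) (addnS _ _)).
rewrite addn0; congr (_ <= _); apply: eq_bigr => i _.
by rewrite exprD -[_ ^+ M.*2]signr_odd odd_double mul1r.
Qed.

End Leibniz.
End AlternatingSums.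

(** * The limiting even density as a function of the shift *)

Section EvenDensity.
Variable R : realType.
Implicit Types (alpha beta : R) (i : nat).

(** The asymptotic density of the indices whose term is at least [i + 2]. Starting at level 2 keeps
    the denominator at least 1 for [alpha <= 1]. *)
Definition shift_recip alpha i : R := (2 - alpha + i%:R)^-1.

Definition even_density alpha : R := altlim (shift_recip alpha).

Lemma shift_denom_gt0 alpha i : alpha <= 1 -> 0 < 2 - alpha + i%:R :> R.
Proof. by move=> a1; have := ler0n R i; lra. Qed.

Lemma shift_recip_ge0 alpha i : alpha <= 1 -> 0 <= shift_recip alpha i.
Proof. by move=> a1; rewrite invr_ge0 ltW ?shift_denom_gt0. Qed.

Lemma shift_recip_noninc alpha i :
  alpha <= 1 -> shift_recip alpha i.+1 <= shift_recip alpha i.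
Proof.
move=> a1; rewrite lef_pV2 ?posrE ?shift_denom_gt0 //.
by rewrite lerD2l ler_nat.
Qed.

Lemma shift_recip_le alpha i : alpha <= 1 -> shift_recip alpha i <= i.+1%:R^-1.
Proof.
move=> a1; rewrite lef_pV2 ?posrE ?shift_denom_gt0 ?ltr0Sn //.
rewrite -natr1; lra.
Qed.

(** In this factored form the difference is visibly nonnegative and nonincreasing in [i] when
    [alpha <= beta], so the Leibniz bounds apply to it. *)
Lemma shift_recipB alpha beta i : alpha <= 1 -> beta <= 1 ->
  shift_recip beta i - shift_recip alpha i =
  (beta - alpha) * (shift_recip beta i * shift_recip alpha i).
Proof.
move=> a1 b1; rewrite /shift_recip.
have := shift_denom_gt0 i a1; have := shift_denom_gt0 i b1.
by move=> /lt0r_neq0 bn0 /lt0r_neq0 an0; field; apply/andP.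
Qed.

Lemma altsum_shift_recip alpha M : alpha <= 1 ->
  `|altsum (shift_recip alpha) M.*2 - even_density alpha| <= M.*2.+1%:R^-1.
Proof.
move=> a1.
have ge0 i := shift_recip_ge0 i a1; have noninc i := shift_recip_noninc i a1.
have := altlim_ge ge0 noninc M; have := altlim_leD ge0 noninc M.
have := shift_recip_le M.*2 a1; have := ge0 M.*2; move: (_.+1%:R^-1) => e.
rewrite -/(even_density alpha) ler_norml; lra.
Qed.

Lemma even_densityB alpha beta : alpha < beta -> beta <= 1 ->
  0 < even_density beta - even_density alpha <= beta - alpha.
Proof.
move=> ab b1; have a1 : alpha <= 1 by lra.
pose d := shift_recip beta \- shift_recip alpha.
have dE i : d i = (beta - alpha) * (shift_recip beta i * shift_recip alpha i).
  exact: shift_recipB.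
have d_ge0 i : 0 <= d i.
  by rewrite dE !mulr_ge0 ?shift_recip_ge0 // subr_ge0 ltW.
have d_noninc i : d i.+1 <= d i.
  rewrite !dE; apply: ler_wpM2l; first by rewrite subr_ge0 ltW.
  by apply: ler_pM; rewrite ?shift_recip_ge0 ?shift_recip_noninc.
have -> : even_density beta - even_density alpha = altlim d.
  rewrite /even_density /altlim -limB.
  - by congr (limn _); apply/funext => M; rewrite altsumB.
  - by apply: is_cvg_altsum => i; rewrite ?shift_recip_ge0 ?shift_recip_noninc.
  - by apply: is_cvg_altsum => i; rewrite ?shift_recip_ge0 ?shift_recip_noninc.
(* Strict positivity comes from the first pair [d 0 - d 1], the even partial sum that bounds the
   limit from below. *)
have d1_lt : d 1%N < d 0%N.
  rewrite !dE ltr_pM2l ?subr_gt0 //.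
  apply: ltr_pM; rewrite ?shift_recip_ge0 // /shift_recip.
    by rewrite ltf_pV2 ?posrE ?shift_denom_gt0 // ltrD2l ltr_nat.
  by rewrite ltf_pV2 ?posrE ?shift_denom_gt0 // ltrD2l ltr_nat.
(* Both reciprocals at index 0 are at most 1, which gives the Lipschitz constant 1. *)
have d0_le : d 0%N <= beta - alpha.
  rewrite dE -[leRHS]mulr1; apply: ler_wpM2l; first by rewrite subr_ge0 ltW.
  have := shift_recip_le 0 a1; have := shift_recip_le 0 b1.
  rewrite invr1 => ub ua.
  by rewrite -[leRHS]mulr1; apply: ler_pM; rewrite ?shift_recip_ge0.
apply/andP; split; last exact: le_trans (altlim_le d_ge0 d_noninc) d0_le.
apply: lt_le_trans (altlim_ge d_ge0 d_noninc 1).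
by rewrite altsum_doubleS /altsum big_ord0 add0r subr_gt0.
Qed.

Lemma even_density_inj alpha beta : alpha <= 1 -> beta <= 1 ->
  even_density alpha = even_density beta -> alpha = beta.
Proof.
move=> a1 b1 eqd; case: (ltgtP alpha beta) => // lt_.
  by have := even_densityB lt_ b1; rewrite eqd subrr ltxx.
by have := even_densityB lt_ a1; rewrite eqd subrr ltxx.
Qed.

Lemma even_density_lipschitz alpha beta : alpha <= 1 -> beta <= 1 ->
  `|even_density alpha - even_density beta| <= `|alpha - beta|.
Proof.
move=> a1 b1; case: (ltgtP alpha beta) => [lt_|lt_|->]; last by rewrite !subrr.
- have /andP[gt0 le_] := even_densityB lt_ b1.
  by rewrite distrC gtr0_norm // distrC gtr0_norm // subr_gt0.
- have /andP[gt0 le_] := even_densityB lt_ a1.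
  by rewrite gtr0_norm // gtr0_norm // subr_gt0.
Qed.

Lemma even_density_continuous : {within `[0, 1], continuous even_density}.
Proof.
apply/subspace_continuousP => x /=; rewrite in_itv /= => /andP[_ x1].
apply/cvgrPdist_le => e e_gt0; rewrite near_withinE.
near=> y; rewrite /= in_itv /= => /andP[_ y1].
apply: le_trans (even_density_lipschitz x1 y1) _.
near: y; exact: (@cvgr_dist_le _ _ _ _ _ id x cvg_id).
Unshelve. all: by end_near. Qed.

(** Crude Leibniz bounds suffice at the endpoints: at 0 the sum is at most its first term [1 / 2],
    at 1 it is at least its first pair [1 - 1 / 2]. The intermediate value theorem does the rest. *)
Lemma even_density_half : exists2 alpha, 0 <= alpha <= 1 & even_density alpha = 1 / 2.
Proof.
have d0 : even_density 0 <= 1 / 2.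
  apply: le_trans (altlim_le _ _) _ => [i|i|].
  - by rewrite shift_recip_ge0.
  - by rewrite shift_recip_noninc.
  - by rewrite /shift_recip subr0 addr0 mul1r.
have d1 : 1 / 2 <= even_density 1.
  apply: le_trans (altlim_ge _ _ 1) => [|i|i].
  - rewrite altsum_doubleS /altsum big_ord0 /shift_recip double0 subrK.
    by rewrite addr0 (_ : 2 - 1 = 1) ?invr1; lra.
  - by rewrite shift_recip_ge0.
  - by rewrite shift_recip_noninc.
have half : Num.min (even_density 0) (even_density 1) <= 1 / 2
            <= Num.max (even_density 0) (even_density 1).
  by rewrite ge_min le_max d0 d1 orbT.
have [alpha] := IVT ler01 even_density_continuous half.
by rewrite in_itv /=; exists alpha.
Qed.

End EvenDensity.

(** * Counting the indices whose term reaches a given level *)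

Section Counting.
Variable R : realType.
Implicit Types (alpha nu x K : R) (n k j N : nat).

Lemma sum_bool_le n (P : pred nat) :
  \sum_(1 <= k < n.+1) (P k)%:R <= n%:R :> R.
Proof.
have -> : n%:R = \sum_(1 <= k < n.+1) 1 :> R by rewrite sumr_const_nat subn1.
by apply: ler_sum => k _; case: (P k).
Qed.

(** The count saturates at [n] once [x] exceeds [n], hence the minimum; the [- 1] pays for rounding
    [x] down. *)
Lemma count_le_ge n x :
  Num.min n%:R (x - 1) <= \sum_(1 <= k < n.+1) (k%:R <= x)%R%:R :> R.
Proof.
elim: n => [|n IH]; first by rewrite big_geq // ge_min lexx.
rewrite big_nat_recr //=; move: IH; set s := \sum_(_ <= _ < _) _.
rewrite !ge_min -[n.+1%:R]natr1; case: (lerP (n%:R + 1) x) => /= h /orP[] h';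
  apply/orP; rewrite ?addr0; try (left; lra); right; lra.
Qed.

Lemma count_le_le n x :
  \sum_(1 <= k < n.+1) (k%:R <= x)%R%:R <= Num.max 0 x :> R.
Proof.
have [x_lt0|x_ge0] := ltP x 0.
  rewrite big_nat big1 // => k _.
  by rewrite leNgt (lt_le_trans x_lt0 (ler0n _ _)).
elim: n => [|n IH]; first by rewrite big_geq.
have [le_nx|lt_xn] := lerP n.+1%:R x; last first.
  by rewrite big_nat_recr //= (lt_geF lt_xn) addr0.
exact: le_trans (sum_bool_le _ _) le_nx.
Qed.

(** Reaching a level is a linear condition on [k]. It stays multiplied out because [j - alpha]
    vanishes for [j = 1], [alpha = 1]. *)
Lemma le_floor_term n alpha nu k j : (0 < k)%N ->
  (j%:Z <= floor_term n alpha nu k) = ((j%:R - alpha) * k%:R <= n%:R - nu).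
Proof.
move=> k_gt0; rewrite floor_ge_int -lerBlDr ler_pdivlMr ?ltr0n //.
Qed.

Definition count_ge n alpha nu j : R :=
  \sum_(1 <= k < n.+1) (j%:Z <= floor_term n alpha nu k)%R%:R.

Lemma count_geE n alpha nu j :
  count_ge n alpha nu j =
  \sum_(1 <= k < n.+1) ((j%:R - alpha) * k%:R <= n%:R - nu)%R%:R.
Proof. by apply: eq_big_nat => k /andP[k_gt0 _]; rewrite le_floor_term. Qed.

(** As [0 <= 1 - alpha <= 1], every [k <= n - |nu|] already reaches level 1. This level is treated
    apart: its density is 1, not [1 / (1 - alpha)]. *)
Lemma count_ge1_dist n alpha nu : 0 <= alpha <= 1 ->
  `|count_ge n alpha nu 1 - n%:R| <= `|nu| + 1.
Proof.
move=> /andP[a0 a1].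
have ub : count_ge n alpha nu 1 <= n%:R by exact: sum_bool_le.
have lb : Num.min n%:R (n%:R - `|nu| - 1) <= count_ge n alpha nu 1.
  apply: le_trans (count_le_ge _ _) _; rewrite count_geE.
  apply: ler_sum => k _; case: (lerP k%:R) => //= k_le.
  have -> // : (1 - alpha) * k%:R <= n%:R - nu.
  have := ler_norm nu; have := mulr_ge0 a0 (ler0n R k); lra.
have := normr_ge0 nu; move: lb; rewrite ge_min ler_norml.
by move=> /orP[] lb nu_ge0; apply/andP; split; lra.
Qed.

(** The condition is [k <= (n - nu) * shift_recip alpha i]. Rounding costs at most 1 and the offset
    at most [|nu|], since the reciprocal is at most 1; the error is thus uniform in [i]. *)
Lemma count_geSS_dist n alpha nu i : 0 <= alpha <= 1 ->
  `|count_ge n alpha nu i.+2 - n%:R * shift_recip alpha i| <= `|nu| + 1.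
Proof.
move=> /andP[a0 a1]; have q_gt0 := shift_denom_gt0 i a1.
have f_ge0 := shift_recip_ge0 i a1.
have f_le1 : shift_recip alpha i <= 1.
  by apply: le_trans (shift_recip_le i a1) _; rewrite invf_le1 ?ler1n ?ltr0n.
have -> : count_ge n alpha nu i.+2 =
    \sum_(1 <= k < n.+1) (k%:R <= (n%:R - nu) * shift_recip alpha i)%R%:R.
  rewrite count_geE; apply: eq_bigr => k _.
  rewrite ler_pdivlMr // mulrC -addn2 natrD; congr (_ * _ <= _)%R%:R; ring.
have := count_le_le n ((n%:R - nu) * shift_recip alpha i).
have := count_le_ge n ((n%:R - nu) * shift_recip alpha i).
set s := \sum_(_ <= _ < _) _.
have : `|nu * shift_recip alpha i| <= `|nu|.
  by rewrite normrM (ger0_norm f_ge0) ler_piMr.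
have nf_ge0 : 0 <= n%:R * shift_recip alpha i by rewrite mulr_ge0.
have nf_le : n%:R * shift_recip alpha i <= n%:R by rewrite ler_piMr.
rewrite mulrBl ge_min le_max !ler_norml; have := normr_ge0 nu.
move: (n%:R * _) (nu * _) nf_ge0 nf_le => u v u_ge0 u_le.
move=> nu_ge0 /andP[v1 v2] /orP[] lb /orP[] ub; apply/andP; split; lra.
Qed.

(** * Parity as an alternating sum over levels *)

Lemma altsum_parity N (s : nat) :
  altsum (fun j => (j < s)%:R) N = (odd (minn N s))%:R :> R.
Proof.
elim: N s => [|N IH] [|s].
- by rewrite /altsum big_ord0.
- by rewrite /altsum big_ord0.
- by rewrite /altsum big1 // => i _; rewrite mulr0.
- rewrite altsumSl minnSS /= [altsum _ N]IH.
  by case: odd => /=; rewrite ?subr0 ?subrr.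
Qed.

(** A natural [t] reaches exactly the levels [1..t], and the signs [1 - 1 + 1 - ...] over them sum
    to its parity. An error can arise only if [t > N], where the sum is cut off, or if [t] is
    negative, where the sum is 0 whatever the parity. *)
Lemma parity_dist N (t : int) :
  `|(t == 1 %[mod 2])%Z%:R - altsum (fun j => (j.+1%:Z <= t)%R%:R) N|
    <= (N.+1%:Z <= t)%R%:R + (1 - (1%:Z <= t)%R%:R) :> R.
Proof.
case: t => t; last first.
  rewrite /altsum big1 => [|i _]; last by rewrite mulr0.
  by rewrite !subr0 add0r; case: (_ == _); rewrite ?normr1 ?normr0.
have -> : altsum (fun j => (j.+1%:Z <= t%:Z)%R%:R) N = (odd (minn N t))%:R :> R.
  exact: altsum_parity.
have -> : ((t : int) == 1 %[mod 2])%Z = odd t.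
  by rewrite !modz_nat eqz_nat !modn2; case: odd.
rewrite !lez_nat; case: (ltnP N t) => [lt_Nt|le_tN].
  have -> : (1 <= t)%N by lia.
  by rewrite subrr addr0; case: odd; case: odd;
    rewrite /= ?subrr ?subr0 ?sub0r ?normrN ?normr1 ?normr0.
rewrite subrr normr0 add0r.
by case: (1 <= t)%N; rewrite /= ?subrr ?subr0.
Qed.

Lemma altsum_dist (f g : nat -> R) K N : (forall i, `|f i - g i| <= K) ->
  `|altsum f N - altsum g N| <= N%:R * K.
Proof.
move=> fgK; rewrite -altsumB.
apply: le_trans (ler_norm_sum _ _ _) _.
apply: (@le_trans _ _ (\sum_(i < N) K)); last first.
  by rewrite sumr_const card_ord mulr_natl.
by apply: ler_sum => i _; rewrite normrM normrX normrN1 expr1n mul1r; exact: fgK.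
Qed.

Lemma floor_countE n alpha nu (r : int) (m : nat) :
  (floor_count n alpha nu r m)%:R =
  \sum_(1 <= k < n.+1) (floor_term n alpha nu k == r %[mod m%:Z])%Z%:R :> R.
Proof.
rewrite /floor_count -sum1_card natr_sum.
rewrite big_mkcond big_ord_recl inE /= add0r big_add1 big_mkord /=.
by apply: eq_bigr => k _; rewrite inE lift0 /=; case: (_ == _).
Qed.

Lemma floor_count_even n alpha nu :
  (floor_count n alpha nu 2 2)%:R = n%:R - (floor_count n alpha nu 1 2)%:R :> R.
Proof.
have sum1 : n%:R = \sum_(1 <= k < n.+1) 1 :> R by rewrite sumr_const_nat subn1.
rewrite !floor_countE sum1 -sumrB; apply: eq_bigr => k _.
have := modz_ge0 (floor_term n alpha nu k) (isT : 2%:Z != 0).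
have := ltz_pmod (floor_term n alpha nu k) (isT : 0 < 2%:Z).
case: (_ %% _)%Z => [[|[|]]|] //= _ _; by rewrite ?subr0 ?subrr.
Qed.

(** Level 1 contributes about [n], and the levels [2..N+1] contribute minus the alternating sum of
    [n * shift_recip alpha i]. With [K = |nu| + 1], these [N] levels cost [N * K]; level 1, the
    nonpositive terms and the cut-off level [N + 2] cost one further [K] each, and the cut-off also
    costs its main term [n * shift_recip alpha N]. *)
Lemma odd_count_dist n alpha nu N : 0 <= alpha <= 1 ->
  `|(floor_count n alpha nu 1 2)%:R - n%:R * (1 - altsum (shift_recip alpha) N)|
    <= n%:R * shift_recip alpha N + (N%:R + 3) * (`|nu| + 1).
Proof.
move=> a01; set K := `|nu| + 1.
have odd_err : `|(floor_count n alpha nu 1 2)%:R -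
                altsum (fun j => count_ge n alpha nu j.+1) N.+1|
    <= count_ge n alpha nu N.+2 + (n%:R - count_ge n alpha nu 1).
  (* Exchanging the sums over levels and indices reduces the estimate to [parity_dist] at each
     index. *)
  have -> : altsum (fun j => count_ge n alpha nu j.+1) N.+1 =
      \sum_(1 <= k < n.+1)
        altsum (fun j => (j.+1%:Z <= floor_term n alpha nu k)%R%:R) N.+1.
    by rewrite exchange_big /=; apply: eq_bigr => j _; rewrite -mulr_sumr.
  have -> : n%:R = \sum_(1 <= k < n.+1) 1 :> R by rewrite sumr_const_nat subn1.
  rewrite floor_countE -!sumrB -big_split /=.
  apply: le_trans (ler_norm_sum _ _ _) _.
  by apply: ler_sum => k _; exact: parity_dist.
have main : `|altsum (fun i => count_ge n alpha nu i.+2) N -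
             altsum (fun i => n%:R * shift_recip alpha i) N| <= N%:R * K.
  by apply: altsum_dist => i; exact: count_geSS_dist.
have scal : altsum (fun i => n%:R * shift_recip alpha i) N =
            n%:R * altsum (shift_recip alpha) N.
  by rewrite /altsum mulr_sumr; apply: eq_bigr => i _; rewrite mulrCA.
move: odd_err main (count_ge1_dist n nu a01) (count_geSS_dist n nu N a01).
rewrite altsumSl /= scal mulrBr mulr1 mulrDl -/K !ler_norml.
move=> /andP[? ?] /andP[? ?] /andP[? ?] /andP[? ?]; apply/andP; split; lra.
Qed.

(** * Passage to the limit *)

Lemma odd_density alpha nu : 0 <= alpha <= 1 ->
  (fun n : nat => n%:R^-1 * (floor_count n alpha nu 1 2)%:R : R)
    @ \oo --> 1 - even_density alpha.
Proof.
move=> a01; have /andP[_ a1] := a01.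
apply/cvgrPdist_le => e e_gt0.
(* The cut-off is fixed before [n] grows. The bound [e / 4] serves twice, for the terms above the
   cut-off and for the tail of the series; the other [e / 2] absorbs [B / n]. *)
pose M := Num.truncn (4 / e).
have inv_le : M.*2.+1%:R^-1 <= e / 4.
  rewrite -[leRHS]invrK lef_pV2 ?posrE ?invr_gt0 ?divr_gt0 // invf_div.
  apply: le_trans (ltW (truncnS_gt _)) _; by rewrite ler_nat ltnS -addnn leq_addr.
pose B := (M.*2%:R + 3) * (`|nu| + 1).
near=> n.
have n_gt0 : 0 < n%:R :> R by near: n; exact: nbhs_infty_gtr.
have n_ge : B / (e / 2) <= n%:R by near: n; exact: nbhs_infty_ger.
have := odd_count_dist n nu M.*2 a01.
rewrite -/B; set u := _^-1 * _.
have -> : (floor_count n alpha nu 1 2)%:R = n%:R * u.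
  by rewrite /u mulrA mulfV ?mul1r // gt_eqF.
rewrite -mulrBr normrM (gtr0_norm n_gt0).
have B_le : B <= n%:R * (e / 2) by rewrite -ler_pdivrMr // divr_gt0.
move=> h; have {h} : `|u - (1 - altsum (shift_recip alpha) M.*2)| <= e / 4 + e / 2.
  rewrite -(ler_pM2l n_gt0) mulrDr; apply: le_trans h _.
  by rewrite lerD // ler_pM2l // (le_trans (shift_recip_le _ a1)).
have := le_trans (altsum_shift_recip M a1) inv_le.
rewrite !ler_norml => /andP[? ?] /andP[? ?]; apply/andP; split; lra.
Unshelve. all: by end_near. Qed.

Lemma even_density_cvg alpha nu : 0 <= alpha <= 1 ->
  (fun n : nat => n%:R^-1 * (floor_count n alpha nu 2 2)%:R : R)
    @ \oo --> even_density alpha.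
Proof.
move=> a01; apply/cvgrPdist_le => e e_gt0.
have /cvgrPdist_le/(_ e e_gt0) odd_e := odd_density nu a01.
near=> n.
have n_gt0 : 0 < n%:R :> R by near: n; exact: nbhs_infty_gtr.
rewrite floor_count_even mulrBr mulVf ?gt_eqF //.
set x := _^-1 * _.
have -> : even_density alpha - (1 - x) = - (1 - even_density alpha - x) by ring.
rewrite normrN {}/x; near: n; exact: odd_e.
Unshelve. all: by end_near. Qed.

End Counting.

Theorem mainTheorem8 (R : realType) :
  exists alpha0 : R, 0 <= alpha0 <= 1 /\
    forall nu : R,
      unique (fun alpha : R =>
        [/\ 0 <= alpha <= 1,
            (fun n : nat => n%:R^-1 * (floor_count n alpha nu 1 2)%:R : R)
              @ \oo --> (1 / 2 : R)
          & (fun n : nat => n%:R^-1 * (floor_count n alpha nu 2 2)%:R : R)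
              @ \oo --> (1 / 2 : R)]) alpha0.
Proof.
have [alpha0 a01 half] := even_density_half R.
(* One [alpha0] serves every [nu], because [even_density] does not involve [nu]. *)
exists alpha0; split=> // nu; split.
  split=> //.
    have -> : 1 / 2 = 1 - even_density alpha0 by rewrite half; lra.
    exact: odd_density.
  rewrite -half; exact: even_density_cvg.
move=> alpha [b01 odd_half _]; have /andP[_ a1] := a01; have /andP[_ b1] := b01.
apply: even_density_inj => //.
(* Uniqueness of limits forces the even density of [alpha] to be [1 / 2], that of [alpha0]. *)
have lim_eq : 1 / 2 = 1 - even_density alpha :> R.
  exact: (norm_cvg_unique odd_half (odd_density nu b01)).
by rewrite half; lra.
Qed.
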